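(* Let $n\geq 3$ be a natural number. Then for every natural number $m\ge 1$, $$\sum_{x=1}^{m}x^{n}=(-1)^{n}m(m+1)\left(-\frac{1}{2}+\sum_{i=2}^{n}a_i\,(m+2)(m+3)\cdots(m+i)\right),$$ where $$a_i=\frac{1}{i+1}\sum_{k=1}^{i}\frac{(-1)^{k}k^{n}}{k!\,(i-k)!}\quad\text{for } i=2,3,\ldots,n-1,\qquad\text{and}\qquad a_n=\frac{(-1)^n}{n+1}.$$
   Context: Natural numbers are the positive integers. *)

(* Defs.v *)
From mathcomp Require Import all_boot all_order all_algebra.

Set Implicit Arguments.
Unset Strict Implicit.
Unset Printing Implicit Defensive.

Import GRing.Theory.
Local Open Scope ring_scope.

(* Only the values for 2 <= i <= n are meaningful. *)
Definition coef_a (n i : nat) : rat :=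
  if i == n then (-1) ^+ n / n.+1%:R
  else (i.+1%:R)^-1 *
       \sum_(1 <= k < i.+1) ((-1) ^+ k * k%:R ^+ n) / (k`!%:R * (i - k)`!%:R).

(* Main.v *)
Require Import Defs.
From mathcomp Require Import all_boot all_order all_algebra.
From mathcomp Require Import ring.
Import GRing.Theory.
Local Open Scope ring_scope.

(** The identity comes from expanding a power of [x] in the basis of rising
    factorials [x (x+1) ... (x+i-1)], whose sums over [x] telescope.  The
    coefficients of [(-x)^n] in that basis are the signed Stirling numbers
    [(-1)^i S(n,i)]; by the inclusion-exclusion formula for Stirling numbers
    they equal [\sum_k (-1)^k k^n / (k! (i-k)!)], which is [(i+1) a_i].

    Everything about these coefficients follows from their initial values
    ([stirling_sum0]) and the recurrence [stirling_sumS], which matches the rule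
    [- x * x^(i) = i x^(i) - x^(i+1)] for rising factorials: hence the expansion
    [exprN_rising], the leading coefficient [(-1)^n] and the coefficient [-1] at
    [i = 1].  Summing over [x] with [sum_rising] turns [x^(i)] into
    [m (m+1) ... (m+i) / (i+1)]; the term [i = 0] vanishes, the term [i = 1]
    gives [- m (m+1) / 2], and [m (m+1)] factors out of all the others. *)

Definition rising (x i : nat) : rat := \prod_(0 <= j < i) (x + j)%:R.

Definition stirling_sum (n i : nat) : rat :=
  \sum_(0 <= k < i.+1) ((-1) ^+ k * k%:R ^+ n) / (k`!%:R * (i - k)`!%:R).

Lemma fact_neq0 n : n`!%:R != 0 :> rat.
Proof. by rewrite Num.Theory.pnatr_eq0 -lt0n fact_gt0. Qed.

Lemma risingS x i : rising x i.+1 = rising x i * (x + i)%:R.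
Proof. by rewrite /rising big_nat_recr. Qed.

Lemma rising_shift x i : x%:R * rising x.+1 i = rising x i.+1.
Proof.
rewrite /rising big_nat_recl // addn0; congr (_ * _).
by apply: eq_bigr => j _; rewrite addnS addSn.
Qed.

(** Telescoping: the forward difference of [rising x i.+1] at [x = m] is
    [(i + 1) rising m.+1 i]. *)
Lemma sum_rising m i :
  \sum_(1 <= x < m.+1) rising x i = rising m i.+1 / i.+1%:R.
Proof.
have i1_neq0 : i.+1%:R != 0 :> rat by rewrite Num.Theory.pnatr_eq0.
elim: m => [|m IHm].
  by rewrite big_nil -rising_shift mul0r mul0r.
rewrite big_nat_recr //= IHm -rising_shift risingS.
apply: (mulIf i1_neq0); rewrite mulrDl !mulfVK // addSn -addnS natrD.
by ring.
Qed.

(** For [n = 0] the sum is [(1 - 1)^i / i!]. *)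
Lemma stirling_sum0 i : stirling_sum 0 i = (i == 0%N)%:R.
Proof.
have -> : stirling_sum 0 i = (1 - 1) ^+ i / i`!%:R.
  rewrite /stirling_sum exprBn big_mkord mulr_suml; apply: eq_bigr => k _.
  have le_ki : (k <= i)%N by rewrite -ltnS.
  rewrite expr0 !expr1n !mulr1 -(bin_fact le_ki) !natrM -mulr_natr.
  have bin_neq0 : 'C(i, k)%:R != 0 :> rat.
    by rewrite Num.Theory.pnatr_eq0 -lt0n bin_gt0.
  field.
  by rewrite bin_neq0 !fact_neq0.
by rewrite subrr expr0n; case: i => [|i] /=; rewrite ?mul0r // divr1.
Qed.

Lemma stirling_sumS0 n : stirling_sum n.+1 0 = 0.
Proof. by rewrite /stirling_sum big_nat1 expr0n mulr0 mul0r. Qed.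

(** Split one factor [k] of [k^(n+1)] as [(i+1) - (i+1-k)]; the second part
    cancels against [(i+1-k)!]. *)
Lemma stirling_sumS n i :
  stirling_sum n.+1 i.+1 = i.+1%:R * stirling_sum n i.+1 - stirling_sum n i.
Proof.
rewrite /stirling_sum big_nat_recr //= [in RHS]big_nat_recr //=.
rewrite mulrDr addrAC mulr_sumr -sumrB; congr (_ + _); last first.
  by rewrite (exprS _ n) mulrCA -!mulrA.
apply: eq_big_nat => k /andP[_ lt_ki].
rewrite subSn // factS exprS natrM.
have -> : i.+1%:R = k%:R + (i - k).+1%:R :> rat by rewrite -natrD addnS subnKC.
field.
by rewrite !fact_neq0 nat1r Num.Theory.pnatr_eq0.
Qed.

Lemma stirling_sum_small n i : (n < i)%N -> stirling_sum n i = 0.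
Proof.
elim: n i => [|n IHn] [|i] // lt_ni; first by rewrite stirling_sum0.
by rewrite stirling_sumS !IHn ?mulr0 ?subr0 // ltnW.
Qed.

Lemma stirling_sum_diag n : stirling_sum n n = (-1) ^+ n.
Proof.
elim: n => [|n IHn]; first by rewrite stirling_sum0.
by rewrite stirling_sumS stirling_sum_small // mulr0 sub0r IHn exprS mulN1r.
Qed.

Lemma stirling_sum1 n : stirling_sum n.+1 1 = -1.
Proof.
elim: n => [|n IHn]; first by rewrite stirling_sum_diag.
by rewrite stirling_sumS IHn stirling_sumS0 mul1r subr0.
Qed.

Lemma exprN_rising n x :
  (- x%:R) ^+ n = \sum_(0 <= i < n.+1) stirling_sum n i * rising x i.
Proof.
elim: n => [|n IHn].
  by rewrite big_nat1 stirling_sum_diag /rising big_nil mulr1.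
rewrite exprS IHn mulr_sumr [RHS]big_nat_recl // stirling_sumS0 mul0r add0r.
rewrite [RHS](eq_bigr (fun i => i.+1%:R * stirling_sum n i.+1 * rising x i.+1
   - stirling_sum n i * rising x i.+1)); last first.
  by move=> i _; rewrite stirling_sumS mulrBl.
rewrite sumrB.
(* The index shift is free at both ends: the added term has coefficient 0 at
   i = 0, and the dropped one has [stirling_sum n n.+1 = 0]. *)
have -> : \sum_(0 <= i < n.+1) i.+1%:R * stirling_sum n i.+1 * rising x i.+1
        = \sum_(0 <= i < n.+1) i%:R * stirling_sum n i * rising x i.
  rewrite big_nat_recr //= stirling_sum_small // mulr0 mul0r addr0.
  by rewrite [RHS]big_nat_recl // !mul0r add0r.
rewrite -sumrB; apply: eq_bigr => i _; rewrite risingS natrD.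
by ring.
Qed.

(** The separate formula for [i = n] is only the closed form of the same sum;
    the term [k = 0] of [stirling_sum] disappears because [0 ^ n = 0]. *)
Lemma coef_aE n i : (0 < n)%N -> coef_a n i = stirling_sum n i / i.+1%:R.
Proof.
rewrite /coef_a; case: eqP => [-> _|_ n_gt0]; first by rewrite stirling_sum_diag.
rewrite mulrC /stirling_sum [in RHS]big_ltn //.
by rewrite expr0n -[n == _]negbK -lt0n n_gt0 mulr0 mul0r add0r.
Qed.

Theorem theorem2p5 (n : nat) (hn : (3 <= n)%N) (m : nat) (hm : (1 <= m)%N) :
  \sum_(1 <= x < m.+1) (x%:R : rat) ^+ n =
  (-1) ^+ n * m%:R * (m + 1)%:R *
  (- (1 / 2%:R) +
   \sum_(2 <= i < n.+1) coef_a n i * \prod_(2 <= j < i.+1) (m + j)%:R).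
Proof.
have n_gt0 : (0 < n)%N by apply: leq_trans hn.
rewrite (eq_bigr (fun x => (-1) ^+ n *
   \sum_(0 <= i < n.+1) stirling_sum n i * rising x i)); last first.
  by move=> x _; rewrite -exprN_rising -exprMn mulN1r opprK.
rewrite -mulr_sumr exchange_big /= -!mulrA; congr (_ * _).
rewrite (eq_bigr (fun i => coef_a n i * rising m i.+1)); last first.
  by move=> i _; rewrite -mulr_sumr sum_rising coef_aE // mulrA mulrAC.
have rising2 i : (0 < i)%N -> rising m i.+1
    = m%:R * ((m + 1)%:R * \prod_(2 <= j < i.+1) (m + j)%:R).
  by move=> i_gt0; rewrite /rising big_ltn // big_ltn // addn0.
rewrite big_ltn // big_ltn //= !coef_aE //.
have -> : stirling_sum n 0 = 0 by rewrite -(prednK n_gt0) stirling_sumS0.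
have -> : stirling_sum n 1 = -1 by rewrite -(prednK n_gt0) stirling_sum1.
rewrite !mul0r add0r rising2 // big_geq // mulr1 !mulrDr; congr (_ + _).
  by ring.
rewrite !mulr_sumr; apply: eq_big_nat => i /andP[i_gt1 _].
rewrite rising2 ?(ltnW i_gt1) //.
by ring.
Qed.
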